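(* Let $\hat{\mu}_{i,k}=\hat{\mu}_i(\bar{Y}_1,\dots,\bar{Y}_k)$ be the SDMMSA estimator of $\mu_i$ computed from $\{(\bar{Y}_v,n_v)\}_{v=1}^k$. For each $i$ and $j$ in $[1,k]$, $\hat{\mu}_{i,k}$, as a function of $\bar{Y}_j$, is nondecreasing when the other $\bar{Y}_{j'}$ ($j'\ne j$) are held fixed. Therefore, in the normal one-way layout, $\hat{\mu}_{i,k}$ is stochastically nondecreasing in $\mu_j$ when the other $\mu_{j'}$ (and $\sigma$) are held fixed; i.e., $P(\hat{\mu}_{i,k}>x)$ is a nondecreasing function of $\mu_j$ for any real number $x$.
   Context: Integer intervals: $[a,b]$ denotes the set of integers from $a$ to $b$. Model: $Y_{ij}=\mu_i+\varepsilon_{ij}$ for $i=0,\dots,k$, $j=1,\dots,n_i$, with independent errors $\varepsilon_{ij}\sim N(0,\sigma^2)$; $\bar{Y}_i$ is the sample mean of $Y_{i1},\dots,Y_{in_i}$, so the $\bar{Y}_i$ are independent with $\bar{Y}_i\sim N(\mu_i,\sigma^2/n_i)$. For $1\le i\le j\le k$ put $n_{i,j}=\sum_{h=i}^j n_h$ and $\bar{Y}_{i,j}=\frac{1}{n_{i,j}}\sum_{h=i}^j n_h\bar{Y}_h$. SDMMSA (step-down maximum mean selection algorithm), applicable to arbitrary real values $\bar{Y}_1,\dots,\bar{Y}_k$ and positive integer weights $n_1,\dots,n_k$: set $i_0=k+1$. Given $i_{u-1}>1$, let $i_u$ be the smallest $j\in[1,i_{u-1}-1]$ such that $\bar{Y}_{j,i_{u-1}-1}=\max_{1\le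 j'\le i_{u-1}-1}\bar{Y}_{j',i_{u-1}-1}$, and define $\hat{\mu}_i=\bar{Y}_{i_u,i_{u-1}-1}$ for all $i\in[i_u,i_{u-1}-1]$. Stop at the first $u=h$ with $i_h=1$. This defines $\hat{\mu}_i$ for every $i\in[1,k]$. *)

(* Defs.v *)
From HB Require Import structures.
From mathcomp Require Import all_boot all_order all_algebra.
From mathcomp Require Import finmap.
From mathcomp Require Import all_classical all_reals all_analysis.

Set Implicit Arguments.
Unset Strict Implicit.
Unset Printing Implicit Defensive.

Import Order.TTheory GRing.Theory Num.Theory.

Local Open Scope classical_set_scope.
Local Open Scope ring_scope.

(* Groups and observations keep their mathematical numbering: groups 0..k,
   observations 1..n_i, as functions on nat of which only the values in range
   are constrained or used. *)

Section sdmmsa.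
Context {R : realType}.
Variables (n : nat -> nat) (Y : nat -> R).

Definition pooled_size (i j : nat) : nat := (\sum_(i <= h < j.+1) n h)%N.

Definition pooled_mean (i j : nat) : R :=
  (\sum_(i <= h < j.+1) (n h)%:R * Y h) / (pooled_size i j)%:R.

(* Maximum of the pooled means over j' in [1, m], for 1 <= m; the initial value
   [pooled_mean m m] is itself one of them. *)
Definition max_pooled_mean (m : nat) : R :=
  \big[Num.max/pooled_mean m m]_(1 <= j < m.+1) pooled_mean j m.

(* The list is increasing, so its head is the smallest maximizer in [1, m]; it
   is nonempty when 1 <= m, and the default is used only for m = 0. *)
Definition first_argmax (m : nat) : nat :=
  head 0%N [seq j <- index_iota 1 m.+1 | pooled_mean j m == max_pooled_mean m].

(* i_u, continued by 0 after the last step h (the one with i_h = 1). *)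
Fixpoint sdmmsa_cut (k u : nat) : nat :=
  if u is u'.+1 then first_argmax (sdmmsa_cut k u').-1 else k.+1.

(* For i in [1, k], the unique u such that i_u <= i <= i_{u-1} - 1 is the first u
   with i_u <= i; it is at most k because the i_u decrease strictly. *)
Definition sdmmsa (k i : nat) : R :=
  let u := find (fun u => (sdmmsa_cut k u <= i)%N) (iota 0 k.+1) in
  pooled_mean (sdmmsa_cut k u) (sdmmsa_cut k u.-1).-1.

End sdmmsa.

Section normal_one_way_layout.
Context {R : realType} {d : measure_display} {T : measurableType d}.
Variable P : probability T R.

Definition mutually_independent (I : choiceType) (D : set I)
    (X : I -> {RV P >-> R}) : Prop :=
  forall (J : {fset I}) (B : I -> set R),
    [set` J] `<=` D ->
    (forall i, i \in J -> measurable (B i)) ->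
    P (\bigcap_(i in [set` J]) (X i @^-1` B i)) =
    (\prod_(i <- J) P (X i @^-1` B i))%E.

(* The laws are compared on measurable sets only: the values of a measure on
   other sets carry no meaning.  The second parameter of [normal_prob] is the
   standard deviation. *)
Definition has_normal_law (X : {RV P >-> R}) (m s : R) : Prop :=
  forall A : set R, measurable A -> distribution P X A = normal_prob m s A.

Definition observation_index (k : nat) (n : nat -> nat) : set (nat * nat) :=
  [set ij | (ij.1 <= k)%N /\ (1 <= ij.2 <= n ij.1)%N].

Definition normal_one_way_layout (k : nat) (n : nat -> nat) (mu : nat -> R)
    (sigma : R) (Y : nat -> nat -> {RV P >-> R}) : Prop :=
  [/\ forall i, (i <= k)%N -> (0 < n i)%N,
      0 < sigma
    & exists eps : nat -> nat -> {RV P >-> R},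
      [/\ forall i j, observation_index k n (i, j) ->
            forall w, Y i j w = mu i + eps i j w,
          forall i j, observation_index k n (i, j) ->
            has_normal_law (eps i j) 0 sigma
        & mutually_independent (observation_index k n)
            (fun ij => eps ij.1 ij.2)]].

Definition sample_mean (n : nat -> nat) (Y : nat -> nat -> {RV P >-> R})
    (i : nat) (w : T) : R :=
  (\sum_(1 <= j < (n i).+1) Y i j w) / (n i)%:R.

End normal_one_way_layout.

Arguments normal_one_way_layout {R d T} P k n mu sigma Y.

(* Main.v *)
Require Import Defs.
From HB Require Import structures.
From mathcomp Require Import all_boot all_order all_algebra.
From mathcomp Require Import all_classical all_reals all_analysis.
From mathcomp Require Import measurable_realfun lra.

Set Implicit Arguments.
Unset Strict Implicit.
Unset Printing Implicit Defensive.

Import Order.TTheory GRing.Theory Num.Theory.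
Import numFieldNormedType.Exports.

Local Open Scope classical_set_scope.
Local Open Scope ring_scope.

(** Write M(s,t) for [pooled_mean n Y s t].  The estimator is isotonic
    regression in disguise and obeys the min-max formula
      mu_i = min_(i <= t <= k) max_(1 <= s <= i) M(s,t),
    whose right-hand side is visibly nondecreasing in every Y_v.  What is used
    is the formula cut into two halves: some t has M(s,t) <= mu_i for all s
    ([sdmmsa_ge]), and every t has an s with mu_i <= M(s,t) ([sdmmsa_le]).
    Let [a,b] be the block of i, whose mean is its value.  The first half holds with t = b, because the
    value of the block is the largest mean of a segment ending at b.  The second
    holds with s = a: when t is in the block, the rest (t,b] of the block has
    mean at most that of the block, hence [a,t] has mean at least that of the
    block; when t is in a later block, one argues by induction on the number of
    blocks after [a,b], since block values increase with the position
    ([sdmmsa_block_min]).  Applying the first half to the larger data and the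
    second to the smaller data at the same t gives monotonicity
    ([homo_sdmmsa]).

    For the stochastic part, the estimator exceeds x exactly when the error
    array belongs to a set E(m) depending on the means only, hence on the mean
    m of group j when the others are fixed, and
    E(m) grows with m by the first part.  The two layouts live on different
    probability spaces, but their error arrays have the same joint law on the
    sigma-algebra generated by the boxes, because independence and the common
    marginals fix the probability of each box, and boxes form a pi-system
    ([eq_joint_law]).  The min-max formula also shows that E(m) belongs to this
    sigma-algebra ([measurable_exceed]). *)

(** * Means of segments and the min-max property *)

Section pooled_means.
Context {R : realType}.
Variables (n : nat -> nat) (k : nat).
Hypothesis n_gt0 : forall v : nat, (1 <= v <= k)%N -> (0 < n v)%N.
Implicit Types (Y : nat -> R) (c : R).

Lemma pooled_size_gt0 s t :
  (1 <= s)%N -> (s <= t <= k)%N -> (0 < pooled_size n s t)%N.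
Proof.
move=> s1 /andP[st tk]; rewrite /pooled_size big_ltn ?ltnS//.
by rewrite addn_gt0 n_gt0// s1 (leq_trans st).
Qed.

(** Comparing M(s,t) with c amounts to the sign of a sum that is additive over
    consecutive segments; this replaces all reasoning on weighted averages. *)
Definition excess Y c s t : R := \sum_(s <= h < t.+1) (n h)%:R * (Y h - c).

Lemma excessE Y c s t : (1 <= s)%N -> (s <= t <= k)%N ->
  excess Y c s t = (pooled_mean n Y s t - c) * (pooled_size n s t)%:R.
Proof.
move=> s1 stk; have N0 : (pooled_size n s t)%:R != 0 :> R.
  by rewrite pnatr_eq0 -lt0n pooled_size_gt0.
rewrite mulrBl divfK// /excess /pooled_size natr_sum mulr_sumr -sumrB.
by apply: eq_bigr => h _; rewrite mulrBr [c * _]mulrC.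
Qed.

Lemma le_pooled_mean Y c s t : (1 <= s)%N -> (s <= t <= k)%N ->
  (c <= pooled_mean n Y s t) = (0 <= excess Y c s t).
Proof.
by move=> s1 stk; rewrite excessE// pmulr_lge0 ?subr_ge0// ltr0n pooled_size_gt0.
Qed.

Lemma pooled_mean_le Y c s t : (1 <= s)%N -> (s <= t <= k)%N ->
  (pooled_mean n Y s t <= c) = (excess Y c s t <= 0).
Proof.
by move=> s1 stk; rewrite excessE// pmulr_lle0 ?subr_le0// ltr0n pooled_size_gt0.
Qed.

Lemma excess_cat Y c s r t : (s <= r.+1)%N -> (r <= t)%N ->
  excess Y c s t = excess Y c s r + excess Y c r.+1 t.
Proof. by move=> sr rt; rewrite /excess (big_cat_nat (n := r.+1)). Qed.

Lemma homo_pooled_mean Y Y' s t : (1 <= s)%N -> (t <= k)%N ->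
  (forall v, (1 <= v <= k)%N -> Y v <= Y' v) ->
  pooled_mean n Y s t <= pooled_mean n Y' s t.
Proof.
move=> s1 tk YY'; rewrite ler_wpM2r ?invr_ge0//.
apply: ler_sum_nat => h /andP[sh ht].
by rewrite ler_wpM2l// YY'// (leq_trans s1)// (leq_trans _ tk).
Qed.

Lemma first_argmaxP Y m (a := first_argmax n Y m) : (1 <= m)%N ->
  (1 <= a <= m)%N /\
  forall s, (1 <= s <= m)%N -> pooled_mean n Y s m <= pooled_mean n Y a m.
Proof.
move=> m1; pose M := max_pooled_mean n Y m.
have [j jm jM] : exists2 j, j \in index_iota 1 m.+1 & pooled_mean n Y j m == M.
  have mm : m \in index_iota 1 m.+1 by rewrite mem_index_iota m1 ltnSn.
  suff H r : {subset r <= index_iota 1 m.+1} ->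
      exists2 j, j \in index_iota 1 m.+1 & pooled_mean n Y j m ==
        \big[Num.max/pooled_mean n Y m m]_(h <- r) pooled_mean n Y h m.
    exact: H.
  elim: r => [_|h r IH sub]; first by exists m; rewrite // big_nil.
  have [|j jm jM] := IH; first by move=> x xr; rewrite sub// inE xr orbT.
  rewrite big_cons; case: leP => _; first by exists j.
  by exists h => //; rewrite sub// inE eqxx.
have : a \in [seq j <- index_iota 1 m.+1 | pooled_mean n Y j m == M].
  rewrite /a /first_argmax -/M.
  have : j \in [seq j <- index_iota 1 m.+1 | pooled_mean n Y j m == M].
    by rewrite mem_filter jM.
  by case: [seq _ <- _ | _] => //= b r _; rewrite inE eqxx.
rewrite mem_filter mem_index_iota ltnS => /andP[/eqP aM am]; split=> // s sm.
rewrite aM; have sin : s \in index_iota 1 m.+1 by rewrite mem_index_iota ltnS.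
exact: (@Order.TotalTheory.le_bigmax_seq _ R _ _ _ s xpredT
  (fun s => pooled_mean n Y s m) sin isT).
Qed.

Lemma sdmmsa_cut_le Y u : (sdmmsa_cut n Y k u <= k.+1 - u)%N.
Proof.
elim: u => [|u IH]/=; first by rewrite subn0.
case: (posnP (sdmmsa_cut n Y k u).-1) => [->|c1].
  by rewrite /first_argmax /index_iota.
have [/andP[_ +] _] := first_argmaxP Y c1.
by move=> /leq_trans; apply; rewrite subnS -!subn1 leq_sub2r.
Qed.

Lemma sdmmsa_cut_predn_le Y u : ((sdmmsa_cut n Y k u).-1 <= k)%N.
Proof.
rewrite -subn1 leq_subLR add1n.
by rewrite (leq_trans (sdmmsa_cut_le Y u))// leq_subr.
Qed.

(** The block [a,b] of i is presented through the cut that bounds it on the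
    right, so that induction on u can run over the blocks from right to left. *)
Lemma sdmmsa_block Y i : (1 <= i <= k)%N ->
  exists u, let b := (sdmmsa_cut n Y k u).-1 in
    let a := first_argmax n Y b in
    (a <= i <= b)%N /\ sdmmsa n Y k i = pooled_mean n Y a b.
Proof.
move=> /andP[i1 ik]; rewrite /sdmmsa.
pose p u := (sdmmsa_cut n Y k u <= i)%N; pose u := find p (iota 0 k.+1).
rewrite -[find _ _]/u.
have hasp : has p (iota 0 k.+1).
  apply/hasP; exists k; first by rewrite mem_iota/= ltnSn.
  by rewrite /p (leq_trans (sdmmsa_cut_le Y k))// subSn// subnn.
have uk : (u < k.+1)%N by have := hasp; rewrite has_find size_iota.
have pu : p u by have := nth_find 0 hasp; rewrite -/u nth_iota.
have u_min v : (v < u)%N -> (i < sdmmsa_cut n Y k v)%N.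
  move=> vu; have := before_find 0 vu.
  by rewrite nth_iota ?(ltn_trans vu)// /p leqNgt => /negbFE.
case: u pu uk u_min => [|u] pu uk u_min.
  by move: pu; rewrite /p /= leqNgt ltnS ik.
exists u; split=> //; apply/andP; split=> //.
by have := u_min u (ltnSn u); case: (sdmmsa_cut n Y k u).
Qed.

(** Removing from the best segment its tail (t,m] cannot lower the mean, since
    that tail, being a competitor ending at m, has a mean no larger. *)
Lemma first_argmax_prefix Y m (a := first_argmax n Y m) t :
  (1 <= m <= k)%N -> (a <= t <= m)%N ->
  pooled_mean n Y a m <= pooled_mean n Y a t.
Proof.
move=> /andP[m1 mk] /andP[at_ tm].
have [/andP[a1 am] amax] := first_argmaxP Y m1.
have [->//|neq_tm] := eqVneq t m.
have {}tm : (t < m)%N by rewrite ltn_neqAle neq_tm.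
set c := pooled_mean n Y _ m in amax *.
rewrite le_pooled_mean ?at_ ?(leq_trans (ltnW tm))//.
have : 0 <= excess Y c a m by rewrite -le_pooled_mean ?am.
rewrite (@excess_cat _ _ _ t) ?(ltnW tm) ?leqW//.
have : excess Y c t.+1 m <= 0 by rewrite -pooled_mean_le ?tm// amax.
lra.
Qed.

(** The start a of a block witnesses, for every t at once, the half of the
    min-max formula that bounds the estimator above by the mean of a segment.
    Inside the block it is [first_argmax_prefix].  Beyond it, the segment is the
    block followed by a segment starting at the next block, which by induction
    has mean at least the value of that next block. *)
Lemma sdmmsa_block_min Y u (b := (sdmmsa_cut n Y k u).-1)
    (a := first_argmax n Y b) t : (1 <= b)%N ->
  (a <= t <= k)%N -> pooled_mean n Y a b <= pooled_mean n Y a t.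
Proof.
rewrite {}/a {}/b; elim: u t => [|u IH] t.
  by move=> k1 at_; apply: first_argmax_prefix; rewrite ?k1/=.
set b' := (sdmmsa_cut n Y k u).-1 in IH; rewrite /= -/b'.
set a' := first_argmax n Y b'; set b := a'.-1; set a := first_argmax n Y b.
move=> b1 /andP[at_ tk].
have b'1 : (1 <= b')%N.
  by rewrite lt0n; apply/eqP => b'0; move: b1; rewrite /b /a' b'0.
have b'k : (b' <= k)%N := sdmmsa_cut_predn_le Y u.
have [/andP[a'1 a'b'] a'max] := first_argmaxP Y b'1.
have [/andP[a1 ab] amax] := first_argmaxP Y b1.
rewrite -/a -/a' in a'1 a'b' a'max a1 ab amax.
have ba' : b.+1 = a' by rewrite prednK.
have bb' : (b <= b')%N by exact: leq_trans (leq_pred a') a'b'.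
have ab' := leq_trans ab bb'.
have bk := leq_trans bb' b'k.
have [tb|bt] := leqP t b; first by apply: first_argmax_prefix; rewrite ?b1 ?at_.
set c := pooled_mean n Y a b.
(* Block values increase: [a,b'] has mean at most M(a',b') because a' was
   preferred to a, so dropping [a',b'] leaves a mean at most M(a',b'). *)
have c_le : c <= pooled_mean n Y a' b'.
  set c' := pooled_mean n Y a' b'.
  have : excess Y c' a b' <= 0.
    by rewrite -pooled_mean_le ?ab'// a'max// a1.
  rewrite (@excess_cat _ _ _ b) ?(leqW ab)// ba'.
  have : 0 <= excess Y c' a' b' by rewrite -le_pooled_mean ?a'b'.
  rewrite pooled_mean_le ?ab//; lra.
have {}c_le : c <= pooled_mean n Y a' t.
  by rewrite (le_trans c_le)// IH// -/a' -ba' bt.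
have : 0 <= excess Y c a' t by rewrite -le_pooled_mean// -ba' bt.
rewrite le_pooled_mean ?at_//.
have : 0 <= excess Y c a b by rewrite -le_pooled_mean// ab.
rewrite [excess Y c a t](@excess_cat _ _ _ b) ?(ltnW bt) ?(leqW ab)// ba'.
lra.
Qed.

Lemma sdmmsa_ge Y i : (1 <= i <= k)%N ->
  exists2 t, (i <= t <= k)%N & forall s, (1 <= s <= i)%N ->
    pooled_mean n Y s t <= sdmmsa n Y k i.
Proof.
move=> ik; have [u /= [/andP[ai ib] ->]] := sdmmsa_block Y ik.
set b := (_).-1 in ai ib *.
have bk : (b <= k)%N := sdmmsa_cut_predn_le Y u.
move: ik => /andP[i1 ik].
exists b; first by rewrite ib.
move=> s /andP[s1 si].
have [|_] := @first_argmaxP Y b; first exact: leq_trans ib.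
by apply; rewrite s1 (leq_trans si).
Qed.

Lemma sdmmsa_le Y i t : (1 <= i <= k)%N -> (i <= t <= k)%N ->
  exists2 s, (1 <= s <= i)%N & sdmmsa n Y k i <= pooled_mean n Y s t.
Proof.
move=> ik /andP[it tk]; have [u /= [/andP[ai ib] ->]] := sdmmsa_block Y ik.
move: ik => /andP[i1 ik].
have b1 := leq_trans i1 ib.
have [/andP[a1 _] _] := first_argmaxP Y b1.
eexists; last by apply: sdmmsa_block_min => //; rewrite tk (leq_trans ai).
by rewrite a1.
Qed.

Lemma homo_sdmmsa Y Y' i : (1 <= i <= k)%N ->
  (forall v, (1 <= v <= k)%N -> Y v <= Y' v) ->
  sdmmsa n Y k i <= sdmmsa n Y' k i.
Proof.
move=> ik YY'; have [t itk geY'] := sdmmsa_ge Y' ik.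
have [s si leY] := sdmmsa_le Y ik itk.
have /andP[s1 _] := si; have /andP[_ tk] := itk.
exact: le_trans leY (le_trans (homo_pooled_mean s1 tk YY') (geY' _ si)).
Qed.

Lemma eq_sdmmsa Y Y' i : (1 <= i <= k)%N ->
  (forall v, (1 <= v <= k)%N -> Y v = Y' v) ->
  sdmmsa n Y k i = sdmmsa n Y' k i.
Proof.
by move=> ik YY'; apply/le_anti/andP; split; apply: homo_sdmmsa => // v /YY' ->.
Qed.

(** This form of the min-max formula exhibits the event as finitely many
    intersections and unions of half-spaces, whence its measurability. *)
Lemma lt_sdmmsaE Y x i : (1 <= i <= k)%N ->
  x < sdmmsa n Y k i <->
  forall t, (i <= t <= k)%N ->
    exists2 s, (1 <= s <= i)%N & x < pooled_mean n Y s t.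
Proof.
move=> ik; split=> [xm t itk|xM].
  have [s si ms] := sdmmsa_le Y ik itk.
  by exists s => //; exact: lt_le_trans ms.
have [t itk mt] := sdmmsa_ge Y ik.
by have [s si xs] := xM _ itk; exact: lt_le_trans (mt _ si).
Qed.

End pooled_means.

(** * The joint law of a finite independent family *)

Section joint_law.
Context {R : realType} {I : choiceType}.
Variable D : set I.

(** The sides of a box are constrained at all indices in D simultaneously, so
    that boxes are closed under intersection side by side; they generate the
    product sigma-algebra of the coordinates in D when D is finite. *)
Definition boxes : set (set (I -> R)) :=
  [set A | exists2 B : I -> set R, (forall i, measurable (B i)) &
    A = \bigcap_(i in D) [set e | B i (e i)]].

Lemma boxes_setI : setI_closed boxes.
Proof.
move=> _ _ [B mB ->] [C mC ->]; exists (fun i => B i `&` C i).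
  by move=> i; exact: measurableI.
by rewrite -bigcapI.
Qed.

Lemma boxes_setT : boxes setT.
Proof. by exists (fun=> setT) => //; apply/seteqP; split. Qed.

Lemma measurable_coord i : D i ->
  measurable_fun setT (fun e : g_sigma_algebraType boxes => e i).
Proof.
move=> Di _ B mB; rewrite setTI; apply: sub_sigma_algebra.
exists (fun j => if j == i then B else setT).
  by move=> j; case: ifP.
apply/seteqP; split=> [e Be j _|e /(_ _ Di)] /=; last by rewrite eqxx.
by case: eqP => // ->.
Qed.

Hypothesis finD : finite_set D.

Lemma measurable_joint d (T : measurableType d) (X : I -> T -> R) :
  (forall i, D i -> measurable_fun setT (X i)) ->
  measurable_fun setT (fun w => X^~ w : g_sigma_algebraType boxes).
Proof.
move=> mX.
apply: (@measurability _ _ T (g_sigma_algebraType boxes) _ _ boxes erefl).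
move=> _ [_ [B mB ->] <-].
rewrite setTI preimage_bigcap; apply: fin_bigcap_measurable => // i Di.
by rewrite -[X in measurable X]setTI; exact: mX.
Qed.

(** The two laws agree on boxes by independence, and boxes form a pi-system
    containing the whole space. *)
Lemma eq_joint_law d1 d2 (T1 : measurableType d1) (T2 : measurableType d2)
    (P1 : probability T1 R) (P2 : probability T2 R)
    (X1 : I -> {RV P1 >-> R}) (X2 : I -> {RV P2 >-> R}) :
  mutually_independent D X1 -> mutually_independent D X2 ->
  (forall i B, D i -> measurable B -> P1 (X1 i @^-1` B) = P2 (X2 i @^-1` B)) ->
  forall A : set (g_sigma_algebraType boxes), measurable A ->
    P1 [set w | A (X1^~ w)] = P2 [set w | A (X2^~ w)].
Proof.
move=> ind1 ind2 eqlaw A mA.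
have mX1 := @measurable_joint _ T1 X1 (fun i _ => measurable_funPT (X1 i)).
have mX2 := @measurable_joint _ T2 X2 (fun i _ => measurable_funPT (X2 i)).
pose f1 : {mfun T1 >-> g_sigma_algebraType boxes} :=
  HB.pack (fun w => X1^~ w) (isMeasurableFun.Build _ _ _ _ _ mX1).
pose f2 : {mfun T2 >-> g_sigma_algebraType boxes} :=
  HB.pack (fun w => X2^~ w) (isMeasurableFun.Build _ _ _ _ _ mX2).
have : distribution P1 f1 A = distribution P2 f2 A.
  apply: (@measure_unique _ R (g_sigma_algebraType boxes) boxes (fun=> setT)
    erefl boxes_setI) => //.
  - by move=> _; exact: boxes_setT.
  - by rewrite bigcup_const//; exists 0%N.
  - move=> _ [B mB ->]; set C := \bigcap_(i in D) _.
    change (P1 (f1 @^-1` C) = P2 (f2 @^-1` C)); rewrite /C !preimage_bigcap.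
    have DE := fset_setK finD.
    have := ind1 (fset_set D) B; have := ind2 (fset_set D) B.
    rewrite DE => -> // -> //.
    by apply: eq_big_seq => i; rewrite in_fset_set// inE => Di; exact: eqlaw.
  - by move=> _; change (P1 (f1 @^-1` setT) < +oo)%E;
      rewrite preimage_setT probability_setT ltry.
by [].
Qed.

End joint_law.

(** * The exceedance event as a set of error arrays *)

Section exceedance.
Context {R : realType}.
Variables (n : nat -> nat) (k : nat).
Hypothesis n_gt0 : forall v : nat, (1 <= v <= k)%N -> (0 < n v)%N.

Local Notation D := (observation_index k n).
Local Notation noise := (g_sigma_algebraType (boxes D : set (set (_ -> R)))).

Lemma finite_observation_index : finite_set D.
Proof.
pose N := (\max_(i < k.+1) n i)%N.
apply: (@sub_finite_set _ _ (`I_k.+1 `*` `I_N.+1)); last exact: finite_setX.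
move=> [v l] /= [vk /andP[_ ln]]; split=> /=; first by rewrite ltnS.
by rewrite ltnS (leq_trans ln)// (leq_bigmax (Ordinal (vk : (v < k.+1)%N))).
Qed.

(** Only the coordinates of actual observations are measurable, so the summands
    can be assumed measurable for the indices that occur and no others. *)
Lemma measurable_sum_seq d (T : measurableType d) (J : eqType) (s : seq J)
    (h : J -> T -> R) :
  (forall j, j \in s -> measurable_fun setT (h j)) ->
  measurable_fun setT (fun w => \sum_(j <- s) h j w).
Proof.
move=> mh; under eq_fun do rewrite big_seq big_mkcond.
apply: measurable_sum => j; have [js|//] := boolP (j \in s); exact: mh.
Qed.

(** The sample mean of group v as a function of the error array, which carries
    the common law of both layouts. *)
Definition noisy_mean (mu : nat -> R) (e : nat * nat -> R) (v : nat) : R :=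
  (\sum_(1 <= l < (n v).+1) (mu v + e (v, l))) / (n v)%:R.

Lemma homo_noisy_mean mu mu' e v : mu v <= mu' v ->
  noisy_mean mu e v <= noisy_mean mu' e v.
Proof.
by move=> mm; rewrite ler_wpM2r ?invr_ge0// ler_sum// => l _; rewrite lerD2r.
Qed.

Lemma measurable_noisy_mean mu v : (v <= k)%N ->
  measurable_fun setT (fun e : noise => noisy_mean mu e v).
Proof.
move=> vk; apply: measurable_funM => //; apply: measurable_sum_seq => l.
rewrite mem_index_iota ltnS => ln.
by apply: measurable_funD => //; apply: measurable_coord.
Qed.

Lemma measurable_pooled_mean mu s t : (t <= k)%N ->
  measurable_fun setT (fun e : noise => pooled_mean n (noisy_mean mu e) s t).
Proof.
move=> tk; apply: measurable_funM => //; apply: measurable_sum_seq => h.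
rewrite mem_index_iota ltnS => /andP[_ ht].
by apply: measurable_funM => //; apply: measurable_noisy_mean;
  exact: leq_trans tk.
Qed.

Lemma measurable_exceed mu x i : (1 <= i <= k)%N ->
  measurable [set e : noise | x < sdmmsa n (noisy_mean mu e) k i].
Proof.
move=> ik.
have -> : [set e : noise | x < sdmmsa n (noisy_mean mu e) k i] =
    \bigcap_(t in [set t | (i <= t <= k)%N])
      \bigcup_(s in [set s | (1 <= s <= i)%N])
        [set e : noise | x < pooled_mean n (noisy_mean mu e) s t].
  by apply/seteqP; split=> e /=; rewrite lt_sdmmsaE.
apply: bigcap_measurableType => t /= /andP[_ tk].
apply: bigcup_measurable => s _.
rewrite -[X in measurable X]setTI.
have := measurable_pooled_mean mu s tk measurableT (measurable_itv `]x, +oo[).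
by congr measurable; apply/seteqP; split=> e /=; rewrite in_itv/= andbT.
Qed.

End exceedance.

Theorem theorem3 (R : realType) (k : nat) (n : nat -> nat)
    (n_gt0 : forall v : nat, (1 <= v <= k)%N -> (0 < n v)%N)
    (i j : nat) (hi : (1 <= i <= k)%N) (hj : (1 <= j <= k)%N) :
  (forall Ybar : nat -> R,
     nondecreasing_fun (fun y : R => sdmmsa n (dfwith Ybar j y) k i))
  /\
  (forall (mu : nat -> R) (sigma : R)
     (d1 d2 : measure_display)
     (T1 : measurableType d1) (T2 : measurableType d2)
     (P1 : probability T1 R) (P2 : probability T2 R)
     (Y1 : nat -> nat -> {RV P1 >-> R}) (Y2 : nat -> nat -> {RV P2 >-> R})
     (m1 m2 x : R),
     m1 <= m2 ->
     normal_one_way_layout P1 k n (dfwith mu j m1) sigma Y1 ->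
     normal_one_way_layout P2 k n (dfwith mu j m2) sigma Y2 ->
     (P1 [set w | (x < sdmmsa n (fun v => sample_mean n Y1 v w) k i)%R] <=
      P2 [set w | (x < sdmmsa n (fun v => sample_mean n Y2 v w) k i)%R])%E).
Proof.
have le_dfwith (f : nat -> R) y y' v : y <= y' -> dfwith f j y v <= dfwith f j y' v.
  move=> yy'; have [->|vj] := eqVneq v j; first by rewrite !dfwithin.
  by rewrite !dfwithout// eq_sym.
split=> [Ybar y y' yy'|mu sigma d1 d2 T1 T2 P1 P2 Y1 Y2 m1 m2 x m12].
  by apply: homo_sdmmsa => // v _; exact: le_dfwith.
move=> [_ _ [e1 [Y1E law1 ind1]]] [_ _ [e2 [Y2E law2 ind2]]].
(* The means enter through E and the probability through the errors only. *)
set E := fun m : R => [set e | x < sdmmsa n (noisy_mean n (dfwith mu j m) e) k i].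
have meanE d (T : measurableType d) (P : probability T R)
    (Y e : nat -> nat -> {RV P >-> R}) m :
    (forall v l, observation_index k n (v, l) ->
      forall w, Y v l w = dfwith mu j m v + e v l w) ->
    [set w | x < sdmmsa n (fun v => sample_mean n Y v w) k i] =
    [set w | E m (fun vl => e vl.1 vl.2 w)].
  move=> YE; apply/funext => w; congr (is_true (x < _)).
  apply: (eq_sdmmsa n_gt0) => // v /andP[_ vk]; congr (_ / _).
  by apply: eq_big_nat => l ln; rewrite YE.
rewrite (meanE _ _ _ _ _ _ Y1E) (meanE _ _ _ _ _ _ Y2E).
have mE m : measurable
    (E m : set (g_sigma_algebraType (boxes (observation_index k n)))).
  exact: measurable_exceed.
have finD := finite_observation_index n k.
(* [le_measure] asks for events in the sample space, not in the noise space. *)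
have mE2 m : measurable [set w | E m (fun vl => e2 vl.1 vl.2 w)].
  rewrite -[X in measurable X]setTI.
  by apply: (measurable_joint finD) => // vl _; exact: measurable_funPT.
rewrite (eq_joint_law finD ind1 ind2)//; last first.
  move=> [v l] B vl mB; have := law1 _ _ vl B mB.
  by rewrite -(law2 _ _ vl B mB).
apply: le_measure; rewrite ?inE// => w /lt_le_trans; apply.
apply: homo_sdmmsa => // v _; exact/homo_noisy_mean/le_dfwith.
Qed.
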